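(* In the $\mathbf{Nil}$ Pappus cylinder configuration described in the context, let $\mathcal{C}_{m^f_1m^f_2m^f_3}$ be the infinite circular cylinder containing the fibre lines $m^f_1,m^f_2,m^f_3$ (and $\overline{m}^f_1,\overline{m}^f_2,\overline{m}^f_3$), and let $g^{\mathbf{Nil}}_{m^f_1m^f_2m^f_3}\subset\mathcal{C}_{m^f_1m^f_2m^f_3}$ be a given geodesic curve that is not a fibre line. Then there always exist geodesic curves (representatives of the equivalence classes of $\mathbf{Nil}$ geodesics belonging to the cylinders of the configuration), none of them a fibre line, $$g^{\mathbf{Nil}}_{A_1B_2\overline{A}_1\overline{B}_2},\quad g^{\mathbf{Nil}}_{A_2B_1\overline{A}_2\overline{B}_1},\quad g^{\mathbf{Nil}}_{A_1B_3\overline{A}_1\overline{B}_3},\quad g^{\mathbf{Nil}}_{A_3B_1\overline{A}_3\overline{B}_1},\quad g^{\mathbf{Nil}}_{A_3B_2\overline{A}_3\overline{B}_2},\quad g^{\mathbf{Nil}}_{A_2B_3\overline{A}_2\overline{B}_3},$$ each contained in the infinite circular cylinder $\mathcal{C}^i$ with the same index, such that there exist intersection points \begin{enumerate} \item $M_1\in m^f_1$ of $g^{\mathbf{Nil}}_{A_1B_2\overline{A}_1\overline{B}_2}$ and $g^{\mathbf{Nil}}_{A_2B_1\overline{A}_2\overline{B}_1}$, \item $M_2\in m^f_2$ of $g^{\mathbf{Nil}}_{A_1B_3\overline{A}_1\overline{B}_3}$ and $g^{\mathbf{Nil}}_{A_3B_1\overline{A}_3\overline{B}_1}$, \item $M_3\in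 m^f_3$ of $g^{\mathbf{Nil}}_{A_3B_2\overline{A}_3\overline{B}_2}$ and $g^{\mathbf{Nil}}_{A_2B_3\overline{A}_2\overline{B}_3}$, \end{enumerate} and $M_1,M_2,M_3$ lie on $g^{\mathbf{Nil}}_{m^f_1m^f_2m^f_3}$.
   Context: $\mathbf{Nil}$ geometry (Heisenberg model): the space $\mathbf{R}^3$ with coordinates $(x,y,z)$ and Riemannian metric $ds^2=dx^2+dy^2+(dz-x\,dy)^2$; it is invariant under the $\mathbf{Nil}$ translations $(a,b,c)\mapsto(x+a,\,y+b,\,z+bx+c)$ with parameters $x,y,z\in\mathbf{R}$. $\mathbf{Nil}$ isometries (congruences) are the isometries of this metric; geodesic curves are the complete geodesics of this metric. Two geodesic curves are equivalent if some $\mathbf{Nil}$ isometry maps one onto the other; the equivalence class belonging to an infinite circular cylinder is the class of the non-fibre geodesics contained in it. The base plane is the plane $z=0$; fibre lines are the straight lines parallel to the $z$-axis. For $r>0$, $\mathcal{C}^i(r)$ is the surface ruled by the fibre lines passing through the points of the Euclidean circle of radius $r$ in the base plane centred at the origin. An infinite circular cylinder is an image of some $\mathcal{C}^i(r)$ under a $\mathbf{Nil}$ isometry; in addition, the Euclidean plane formed by the fibre lines through the points of a Euclidean straight line of the base plane is also called an infinite circular cylinder (of infinite radius). For three distinct points $X,Y,Z$ of the base plane, $\mathcal{C}^i_{XYZ}$ denotes the infinite circular cylinder passing through them, i.e. the union of the fibre lines through the points of the Euclidean circle (or straight line, if they are collinear) through $X,Y,Z$; $\mathcal{C}^i_{XYZW}$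 denotes an infinite circular cylinder through the four points $X,Y,Z,W$. Pappus cylinder configuration. Let $A_1,A_2,A_3,B_1,B_2,B_3$ be six points of the base plane, and let $\overline{A}_1$ be the base-plane point of a fibre line on $\mathcal{C}^i_{A_1A_2A_3}$. Let $\overline{B}_2$, $\overline{A}_3$, $\overline{B}_1$, $\overline{A}_2$, $\overline{B}_3$ be, successively, the base-plane points of the following fibre lines: the common fibre line of $\mathcal{C}^i_{A_1B_2\overline{A}_1}$ and $\mathcal{C}^i_{B_1B_2B_3}$ other than the one through $B_2$; the common fibre line of $\mathcal{C}^i_{B_2A_3\overline{B}_2}$ and $\mathcal{C}^i_{A_1A_2A_3}$ other than the one through $A_3$; the common fibre line of $\mathcal{C}^i_{A_3B_1\overline{A}_3}$ and $\mathcal{C}^i_{B_1B_2B_3}$ other than the one through $B_1$; the common fibre line of $\mathcal{C}^i_{B_1A_2\overline{B}_1}$ and $\mathcal{C}^i_{A_1A_2A_3}$ other than the one through $A_2$; the common fibre line of $\mathcal{C}^i_{A_2B_3\overline{A}_2}$ and $\mathcal{C}^i_{B_1B_2B_3}$ other than the one through $B_3$. (It is a theorem that $\overline{A}_1$ then lies on $\mathcal{C}^i_{B_3A_1\overline{B}_3}$.) Let $m^f_1,\overline{m}^f_1$ be the two fibre lines in which $\mathcal{C}^i_{A_1B_2\overline{A}_1\overline{B}_2}$ and $\mathcal{C}^i_{A_2B_1\overline{A}_2\overline{B}_1}$ meet, $m^f_2,\overline{m}^f_2$ the two fibre lines in which $\mathcal{C}^i_{A_1B_3\overline{A}_1\overline{B}_3}$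 and $\mathcal{C}^i_{A_3B_1\overline{A}_3\overline{B}_1}$ meet, and $m^f_3,\overline{m}^f_3$ the two fibre lines in which $\mathcal{C}^i_{A_3B_2\overline{A}_3\overline{B}_2}$ and $\mathcal{C}^i_{A_2B_3\overline{A}_2\overline{B}_3}$ meet. (It is a theorem that these six fibre lines lie on one infinite circular cylinder.) It is understood that every object named in the construction is well defined: whenever $\mathcal{C}^i_{XYZ}$ is written, $X,Y,Z$ are distinct; whenever two cylinders are intersected, they are different; and the ''other'' intersection fibre lines, and the pairs $m^f_i,\overline{m}^f_i$ of two distinct fibre lines, exist. *)

(* Defs.v *)
From Stdlib Require Import Reals Ensembles.
From Coquelicot Require Import Coquelicot.
Open Scope R_scope.

Definition point : Type := (R * R * R)%type.

(* The point (x, y) of R * R stands for the point (x, y, 0) of the base plane. *)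
Definition base_point : Type := (R * R)%type.

Definition base_proj (p : point) : base_point := fst p.

Inductive axis : Type := ax | ay | az.

Definition coord (i : axis) (p : point) : R :=
  match i with
  | ax => fst (fst p)
  | ay => snd (fst p)
  | az => snd p
  end.

Definition basis (i : axis) : point :=
  match i with
  | ax => (1, 0, 0)
  | ay => (0, 1, 0)
  | az => (0, 0, 1)
  end.

Definition sum_axis (F : axis -> R) : R := F ax + F ay + F az.

(* ds^2 = dx^2 + dy^2 + (dz - x dy)^2, polarized: the inner product of the
   tangent vectors v and w at p. *)
Definition metric (p v w : point) : R :=
  coord ax v * coord ax w + coord ay v * coord ay w
  + (coord az v - coord ax p * coord ay v)
    * (coord az w - coord ax p * coord ay w).

Definition metric_coef (i j : axis) (p : point) : R :=
  metric p (basis i) (basis j).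

Definition partial (i : axis) (f : point -> R) (p : point) : R :=
  Derive (fun t : R => f (plus p (scal t (basis i)))) 0.

(* Christoffel symbols of the first kind: the inner product of
   nabla_(e_i) e_j with e_k. *)
Definition christoffel (k i j : axis) (p : point) : R :=
  / 2 * (partial i (metric_coef j k) p + partial j (metric_coef i k) p
         - partial k (metric_coef i j) p).

(* The equation nabla_(c') c' = 0, tested against each e_k; since the metric is
   nondegenerate this is the usual geodesic equation with its index lowered. *)
Definition geodesic_equation (c : R -> point) : Prop :=
  let c0 i := fun t : R => coord i (c t) in
  forall (t : R) (k : axis),
    sum_axis (fun l => metric_coef k l (c t) * Derive (Derive (c0 l)) t)
    + sum_axis (fun i => sum_axis (fun j =>
        christoffel k i j (c t) * Derive (c0 i) t * Derive (c0 j) t)) = 0.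

(* Geodesic curves are point sets. Completeness is the domain R of the
   parametrization; constant solutions of the equation are excluded. *)
Definition geodesic_curve (g : Ensemble point) : Prop :=
  exists c : R -> point,
    (forall (i : axis) (t : R),
        ex_derive (fun s => coord i (c s)) t
        /\ ex_derive (Derive (fun s => coord i (c s))) t)
    /\ geodesic_equation c
    /\ (exists s t : R, c s <> c t)
    /\ (forall p : point, In _ g p <-> exists t : R, c t = p).

(* A differentiable bijection whose differentials preserve the metric is
   automatically a smooth diffeomorphism. *)
Definition nil_isometry (f : point -> point) : Prop :=
  (exists f' : point -> point,
      (forall p, f' (f p) = p) /\ (forall p, f (f' p) = p))
  /\ forall p : point, exists df : point -> point,
      filterdiff f (locally p) df
      /\ forall v w : point, metric (f p) (df v) (df w) = metric p v w.

Definition nil_equivalent (g h : Ensemble point) : Prop :=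
  exists f : point -> point,
    nil_isometry f
    /\ forall q : point, In _ h q <-> exists p : point, In _ g p /\ f p = q.

Definition fibre (P : base_point) : Ensemble point :=
  fun p => base_proj p = P.

Definition fibre_line (g : Ensemble point) : Prop :=
  exists P : base_point, Same_set _ g (fibre P).

Definition distinct3 {T : Type} (X Y Z : T) : Prop :=
  X <> Y /\ Y <> Z /\ X <> Z.

Definition collinear (X Y Z : base_point) : Prop :=
  (fst Y - fst X) * (snd Z - snd X) = (snd Y - snd X) * (fst Z - fst X).

Definition distance (P Q : base_point) : R :=
  dist_euc (fst P) (snd P) (fst Q) (snd Q).

(* Meaningful for distinct X, Y, Z only. *)
Definition circle_or_line (X Y Z : base_point) : Ensemble base_point :=
  fun P =>
    (collinear X Y Z /\ collinear X Y P)
    \/ (~ collinear X Y Z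
        /\ exists O : base_point,
             distance O X = distance O Y /\ distance O X = distance O Z
             /\ distance O X = distance O P).

(* The infinite circular cylinder through X, Y, Z: the union of the fibre lines
   through the points of circle_or_line X Y Z. *)
Definition cylinder (X Y Z : base_point) : Ensemble point :=
  fun p => exists P : base_point,
    In _ (circle_or_line X Y Z) P /\ In _ (fibre P) p.

(* g is in the equivalence class belonging to C, i.e. the class of the
   non-fibre geodesics contained in C. *)
Definition in_class_of (C g : Ensemble point) : Prop :=
  geodesic_curve g
  /\ exists h : Ensemble point,
       geodesic_curve h /\ ~ fibre_line h /\ Included _ h C
       /\ nil_equivalent h g.

Definition geodesic_on_cylinder (C g : Ensemble point) : Prop :=
  geodesic_curve g /\ ~ fibre_line g /\ Included _ g C /\ in_class_of C g.

(* The fibre line over Q is common to C and D and is not the one over P. Two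
   different cylinders share at most two fibre lines, so Q is determined when
   the fibre line over P is common as well. *)
Definition other_common_fibre (C D : Ensemble point) (P Q : base_point) : Prop :=
  ~ Same_set _ C D
  /\ Included _ (fibre Q) C /\ Included _ (fibre Q) D /\ Q <> P.

Definition meet_in_two_fibres (C D : Ensemble point) (m m' : base_point) : Prop :=
  ~ Same_set _ C D /\ m <> m'
  /\ Same_set _ (Intersection _ C D) (Union _ (fibre m) (fibre m')).

(* Primes stand for overlines. The cylinder through A_i, B_j, A_i', B_j' is given
   below by three of the four points; the fourth lies on it by construction, or,
   in the case of A1' and the cylinder through B3, A1, B3', by the closure
   theorem of the configuration. *)
Record pappus_configuration
  (A1 A2 A3 B1 B2 B3 A1' A2' A3' B1' B2' B3' : base_point) : Prop := {
  pappus_A : distinct3 A1 A2 A3;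
  pappus_B : distinct3 B1 B2 B3;
  pappus_A1' : Included _ (fibre A1') (cylinder A1 A2 A3);
  pappus_A1B2 : distinct3 A1 B2 A1';
  pappus_B2' :
    other_common_fibre (cylinder A1 B2 A1') (cylinder B1 B2 B3) B2 B2';
  pappus_B2A3 : distinct3 B2 A3 B2';
  pappus_A3' :
    other_common_fibre (cylinder B2 A3 B2') (cylinder A1 A2 A3) A3 A3';
  pappus_A3B1 : distinct3 A3 B1 A3';
  pappus_B1' :
    other_common_fibre (cylinder A3 B1 A3') (cylinder B1 B2 B3) B1 B1';
  pappus_B1A2 : distinct3 B1 A2 B1';
  pappus_A2' :
    other_common_fibre (cylinder B1 A2 B1') (cylinder A1 A2 A3) A2 A2';
  pappus_A2B3 : distinct3 A2 B3 A2';
  pappus_B3' :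
    other_common_fibre (cylinder A2 B3 A2') (cylinder B1 B2 B3) B3 B3';
  pappus_B3A1 : distinct3 B3 A1 B3'
}.

(* Main.v *)
(* Each of the six cylinders of the configuration is used for only one of the
   intersection points, so the six geodesics can be chosen independently. The
   projection of a non-fibre geodesic to the base plane is a complete line or
   circle; when the geodesic lies on a cylinder, it is therefore the whole base
   curve of that cylinder, and the given geodesic meets each fibre m_i in some
   M_i. Conversely, through every point of a cylinder passes a non-fibre geodesic
   lying on that cylinder. *)
Require Import Defs.
From Stdlib Require Import Reals Ensembles.
From Stdlib Require Import Lra.
From Coquelicot Require Import Coquelicot.
Open Scope R_scope.

(** * Lines and circles of the base plane *)

(** The common form in which base curves of cylinders and projections of geodesics are compared. In
    the second case [s] is the squared radius, and [0 < s] rules out single points. *)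
Definition line_or_circle (S : Ensemble base_point) : Prop :=
  (exists a b k : R,
      a * a + b * b <> 0
      /\ forall x y, In _ S (x, y) <-> a * x + b * y = k)
  \/ (exists u v s : R,
      0 < s
      /\ forall x y, In _ S (x, y) <->
           (x - u) * (x - u) + (y - v) * (y - v) = s).

Lemma distance_eq_iff (O P Q : base_point) :
  distance O P = distance O Q <->
  (fst P - fst O) * (fst P - fst O) + (snd P - snd O) * (snd P - snd O)
  = (fst Q - fst O) * (fst Q - fst O) + (snd Q - snd O) * (snd Q - snd O).
Proof.
  unfold distance, dist_euc. split; intros H.
  - apply sqrt_inj in H; [unfold Rsqr in H; lra | |];
      apply Rplus_le_le_0_compat; apply Rle_0_sqr.
  - f_equal. unfold Rsqr. lra.
Qed.

(** For collinear points the equation defining [collinear] is already that of a line. Otherwise the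
    circumcentre is computed explicitly, and its uniqueness turns the existential centre in
    [circle_or_line] into a single circle equation. *)
Lemma circle_or_line_vertices (X Y Z : base_point) :
  distinct3 X Y Z ->
  line_or_circle (circle_or_line X Y Z)
  /\ In _ (circle_or_line X Y Z) X
  /\ In _ (circle_or_line X Y Z) Y
  /\ In _ (circle_or_line X Y Z) Z.
Proof.
  destruct X as [x1 y1], Y as [x2 y2], Z as [x3 y3].
  intros (HXY & HYZ & HXZ).
  destruct (Req_dec ((x2 - x1) * (y3 - y1)) ((y2 - y1) * (x3 - x1))) as [Hc | Hc].
  - assert (Hin : forall x y,
      In _ (circle_or_line (x1, y1) (x2, y2) (x3, y3)) (x, y) <->
      (x2 - x1) * (y - y1) = (y2 - y1) * (x - x1)).
    { intros x y. unfold In, circle_or_line, collinear; simpl. tauto. }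
    split; [left | rewrite !Hin; repeat split; lra].
    exists (y2 - y1), (x1 - x2), ((y2 - y1) * x1 + (x1 - x2) * y1). split.
    + intros H. apply Rplus_sqr_eq_0 in H. apply HXY. f_equal; lra.
    + intros x y. rewrite Hin. split; lra.
  - pose (D := 2 * ((x2 - x1) * (y3 - y1) - (y2 - y1) * (x3 - x1))).
    assert (HD : D <> 0) by (unfold D; lra).
    pose (p := (x2 - x1) * (x2 - x1) + (y2 - y1) * (y2 - y1)).
    pose (q := (x3 - x1) * (x3 - x1) + (y3 - y1) * (y3 - y1)).
    (* Cramer's rule for the perpendicular bisectors of XY and XZ, whose equations are [Hp] and
       [Hq]. *)
    pose (u := x1 + (p * (y3 - y1) - q * (y2 - y1)) / D).
    pose (v := y1 + (q * (x2 - x1) - p * (x3 - x1)) / D).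
    assert (Hp : 2 * (x2 - x1) * (u - x1) + 2 * (y2 - y1) * (v - y1) = p).
    { unfold u, v, D in *. field. lra. }
    assert (Hq : 2 * (x3 - x1) * (u - x1) + 2 * (y3 - y1) * (v - y1) = q).
    { unfold u, v, D in *. field. lra. }
    assert (Hin : forall x y,
      In _ (circle_or_line (x1, y1) (x2, y2) (x3, y3)) (x, y) <->
      (x - u) * (x - u) + (y - v) * (y - v)
      = (x1 - u) * (x1 - u) + (y1 - v) * (y1 - v)).
    { intros x y. unfold In, circle_or_line, collinear. simpl fst. simpl snd. split.
      - intros [[H _] | (_ & [o1 o2] & HY & HZ & HP)]; [lra |].
        apply distance_eq_iff in HY, HZ, HP. simpl in HY, HZ, HP.
        (* The offset of an equidistant point [(o1, o2)] from [(u, v)] solves a homogeneous linear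
           system with determinant D/2, so it vanishes. *)
        assert (HY' : (x2 - x1) * (o1 - u) + (y2 - y1) * (o2 - v) = 0)
          by (unfold p in Hp; lra).
        assert (HZ' : (x3 - x1) * (o1 - u) + (y3 - y1) * (o2 - v) = 0)
          by (unfold q in Hq; lra).
        assert (Eu : D * (o1 - u) = 0).
        { replace (D * (o1 - u)) with
            (2 * ((y3 - y1) * ((x2 - x1) * (o1 - u) + (y2 - y1) * (o2 - v))
             - (y2 - y1) * ((x3 - x1) * (o1 - u) + (y3 - y1) * (o2 - v))))
            by (unfold D; ring). rewrite HY', HZ'. ring. }
        assert (Ev : D * (o2 - v) = 0).
        { replace (D * (o2 - v)) with
            (2 * ((x2 - x1) * ((x3 - x1) * (o1 - u) + (y3 - y1) * (o2 - v))
             - (x3 - x1) * ((x2 - x1) * (o1 - u) + (y2 - y1) * (o2 - v))))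
            by (unfold D; ring). rewrite HY', HZ'. ring. }
        apply Rmult_integral in Eu, Ev.
        replace u with o1 by lra. replace v with o2 by lra. lra.
      - intros H. right. split; [exact Hc |]. exists (u, v).
        rewrite !distance_eq_iff. simpl. unfold p, q in Hp, Hq. lra. }
    split; [right | rewrite !Hin; unfold p, q in Hp, Hq; repeat split; lra].
    exists u, v, ((x1 - u) * (x1 - u) + (y1 - v) * (y1 - v)). split; [| exact Hin].
    (* Radius zero would place the centre at X; then [Hp] gives p = 0, that is X = Y. *)
    destruct (Rle_lt_or_eq_dec _ _
      (Rplus_le_le_0_compat _ _ (Rle_0_sqr (x1 - u)) (Rle_0_sqr (y1 - v))))
      as [Hpos | H0]; [exact Hpos | exfalso].
    symmetry in H0. apply Rplus_sqr_eq_0 in H0. destruct H0 as [Eu Ev].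
    replace (u - x1) with 0 in Hp by lra. replace (v - y1) with 0 in Hp by lra.
    rewrite !Rmult_0_r, Rplus_0_l in Hp. symmetry in Hp.
    apply Rplus_sqr_eq_0 in Hp. apply HXY. f_equal; lra.
Qed.

(** A few explicit points of S pin down the equation of T: two points of a line against a line,
    three against a circle, and the four axis-parallel extreme points of a circle against either. *)
Lemma line_or_circle_included (S T : Ensemble base_point) :
  line_or_circle S -> line_or_circle T -> Included _ S T -> Included _ T S.
Proof.
  intros [(a & b & k & Hab & HS) | (u & v & s & Hs & HS)]
         [(a' & b' & k' & Hab' & HT) | (u' & v' & s' & Hs' & HT)] Hsub [x y] Hxy;
    assert (Hin : forall x y, In _ S (x, y) -> In _ T (x, y))
      by (intros; apply Hsub; assumption);
    apply HT in Hxy; apply HS.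
  - set (n := a * a + b * b) in *.
    (* The foot of the perpendicular from the origin, moved by t along the direction (-b, a). *)
    assert (Hpt : forall t,
      In _ T (a * k / n - t * b, b * k / n + t * a)).
    { intros t. apply Hin, HS. unfold n in *. field. exact Hab. }
    pose proof (proj1 (HT _ _) (Hpt 0)) as H0.
    pose proof (proj1 (HT _ _) (Hpt 1)) as H1.
    assert (Hpar : a * b' = b * a') by lra.
    assert (Hk : (a' * a + b' * b) * k = n * k').
    { rewrite <- H0. field. exact Hab. }
    (* The normals are parallel, so the equation of T yields that of S multiplied by a' and by b',
       which are not both zero. *)
    assert (Ea : n * (a' * (a * x + b * y - k)) = 0).
    { replace (n * (a' * (a * x + b * y - k))) with
        (a * (n * (a' * x + b' * y) - (a' * a + b' * b) * k)
         + (a * b' - b * a') * (b * k - n * y)) by (unfold n; ring).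
      rewrite Hxy, Hk, Hpar. ring. }
    assert (Eb : n * (b' * (a * x + b * y - k)) = 0).
    { replace (n * (b' * (a * x + b * y - k))) with
        (b * (n * (a' * x + b' * y) - (a' * a + b' * b) * k)
         + (a * b' - b * a') * (n * x - a * k)) by (unfold n; ring).
      rewrite Hxy, Hk, Hpar. ring. }
    apply Rmult_integral in Ea, Eb.
    destruct Ea as [Ea | Ea]; [contradiction |].
    destruct Eb as [Eb | Eb]; [contradiction |].
    apply Rmult_integral in Ea, Eb.
    destruct Ea as [Ea | Ea]; [| lra]. destruct Eb as [Eb | Eb]; [| lra].
    exfalso. apply Hab'. rewrite Ea, Eb. ring.
  (* Along the line the squared distance to the centre is quadratic in t with leading coefficient n.
     Equal values at -1, 0, 1 force n = 0. *)
  - exfalso. set (n := a * a + b * b) in *.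
    assert (Hpt : forall t,
      In _ T (a * k / n - t * b, b * k / n + t * a)).
    { intros t. apply Hin, HS. unfold n in *. field. exact Hab. }
    pose proof (proj1 (HT _ _) (Hpt 0)) as H0.
    pose proof (proj1 (HT _ _) (Hpt 1)) as H1.
    pose proof (proj1 (HT _ _) (Hpt (-1))) as H2.
    apply Hab. unfold n at 1. lra.
  (* Opposite points of the circle satisfy the same linear equation, so a' r = b' r = 0. *)
  - exfalso. pose proof (sqrt_lt_R0 s Hs) as Hr.
    pose proof (sqrt_sqrt s (Rlt_le _ _ Hs)) as Hrr. set (r := sqrt s) in *.
    assert (H1 := proj1 (HT _ _) (Hin (u + r) v ltac:(apply HS; lra))).
    assert (H2 := proj1 (HT _ _) (Hin (u - r) v ltac:(apply HS; lra))).
    assert (H3 := proj1 (HT _ _) (Hin u (v + r) ltac:(apply HS; lra))).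
    assert (H4 := proj1 (HT _ _) (Hin u (v - r) ltac:(apply HS; lra))).
    assert (Ea : a' * r = 0) by lra. assert (Eb : b' * r = 0) by lra.
    apply Rmult_integral in Ea, Eb. apply Hab'. nra.
  (* Opposite points of S are equally far from (u', v'), so the centres agree, and then so do the
     radii. *)
  - pose proof (sqrt_lt_R0 s Hs) as Hr.
    pose proof (sqrt_sqrt s (Rlt_le _ _ Hs)) as Hrr. set (r := sqrt s) in *.
    assert (H1 := proj1 (HT _ _) (Hin (u + r) v ltac:(apply HS; lra))).
    assert (H2 := proj1 (HT _ _) (Hin (u - r) v ltac:(apply HS; lra))).
    assert (H3 := proj1 (HT _ _) (Hin u (v + r) ltac:(apply HS; lra))).
    assert (H4 := proj1 (HT _ _) (Hin u (v - r) ltac:(apply HS; lra))).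
    assert (Eu : (u - u') * r = 0) by lra. assert (Ev : (v - v') * r = 0) by lra.
    apply Rmult_integral in Eu, Ev.
    replace u with u' in * by lra. replace v with v' in * by lra. lra.
Qed.

(** * The geodesic equation in coordinates *)

(** Only g_yy = 1 + x^2 and g_yz = -x are not constant, and they depend on x alone. *)
Lemma partial_metric_coef (i j k : axis) (p : point) :
  partial i (metric_coef j k) p =
  match i, j, k with
  | ax, ay, ay => 2 * coord ax p
  | ax, ay, az | ax, az, ay => - 1
  | _, _, _ => 0
  end.
Proof.
  destruct p as [[x y] z].
  destruct i, j, k; unfold partial, metric_coef, metric; apply is_derive_unique;
    cbn -[Rplus Rmult Rminus Ropp]; auto_derive; trivial; ring.
Qed.

(** Put w = z' - x y', the inner product of the velocity with the fibre direction. The [az]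
    component says w' = 0, solved here for z''; the [ax] component is x'' = -w y'; eliminating z''
    from the [ay] component leaves y'' = w x'. *)
Lemma geodesic_equation_iff (c : R -> point) :
  let x := fun t => coord ax (c t) in
  let y := fun t => coord ay (c t) in
  let z := fun t => coord az (c t) in
  geodesic_equation c <->
  forall t,
    Derive (Derive x) t
      = - (Derive z t - x t * Derive y t) * Derive y t
    /\ Derive (Derive y) t
      = (Derive z t - x t * Derive y t) * Derive x t
    /\ Derive (Derive z) t
      = Derive x t * Derive y t + x t * Derive (Derive y) t.
Proof.
  intros x y z. unfold geodesic_equation, sum_axis, christoffel. fold x y z.
  split; intros H t.
  - pose proof (H t ax) as Hx. pose proof (H t ay) as Hy. pose proof (H t az) as Hz.
    rewrite !partial_metric_coef in Hx, Hy, Hz.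
    unfold metric_coef, metric in Hx, Hy, Hz; simpl in Hx, Hy, Hz.
    fold (coord ax (c t)) in *. fold (x t) in *.
    assert (Hw : Derive (Derive z) t
      = Derive x t * Derive y t + x t * Derive (Derive y) t) by lra.
    rewrite Hw in *. repeat split; lra.
  - destruct (H t) as (Hx & Hy & Hz). intros k. rewrite !partial_metric_coef.
    destruct k; unfold metric_coef, metric; simpl;
      fold (coord ax (c t)); fold (x t); rewrite Hz, Hx, Hy; field.
Qed.

(* [auto_derive] leaves eta-expanded functions, which [rewrite] does not see. *)
Ltac eta_derive :=
  repeat match goal with
  | |- context [Derive (fun s => ?f s)] =>
      progress change (Derive (fun s => f s)) with (Derive f)
  end.

(** * Projection of a non-fibre geodesic to the base plane *)

Lemma derive_zero_constant (f : R -> R) :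
  (forall t, is_derive f t 0) -> forall t, f t = f 0.
Proof.
  intros H t. destruct (Rtotal_order t 0) as [Ht | [-> | Ht]]; [| reflexivity |].
  - apply eq_is_derive; [intros; apply H | exact Ht].
  - symmetry. apply eq_is_derive; [intros; apply H | exact Ht].
Qed.

(** C + iS is the quotient (u + iv) / (p + iq), a complex number of modulus 1. Its argument is
    [acos C] or [- acos C], according to the sign of S. *)
Lemma rotation_to (p q u v : R) :
  p * p + q * q <> 0 -> u * u + v * v = p * p + q * q ->
  exists s, p * cos s - q * sin s = u /\ p * sin s + q * cos s = v.
Proof.
  intros Hn Huv. set (n := p * p + q * q) in *.
  pose (C := (p * u + q * v) / n). pose (S := (p * v - q * u) / n).
  assert (HCS : C² + S² = 1).
  { replace (C² + S²) with (n * (u * u + v * v) / (n * n))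
      by (unfold C, S, Rsqr, n in *; field; exact Hn).
    rewrite Huv. field. exact Hn. }
  assert (Hs : exists s, cos s = C /\ sin s = S).
  { assert (HC : -1 <= C <= 1).
    { pose proof (Rle_0_sqr S). split; unfold Rsqr in *; nra. }
    assert (Hsq : sqrt (1 - C²) = Rabs S).
    { replace (1 - C²) with (S²) by lra. apply sqrt_Rsqr_abs. }
    destruct (Rle_dec 0 S) as [HS | HS].
    - exists (acos C). rewrite cos_acos, sin_acos, Hsq, Rabs_pos_eq by lra.
      split; reflexivity.
    - exists (- acos C). rewrite cos_neg, sin_neg, cos_acos, sin_acos, Hsq by lra.
      rewrite Rabs_left by lra. split; ring. }
  destruct Hs as (s & Hc & Hsn). exists s. rewrite Hc, Hsn.
  unfold C, S, n in *. split; field; exact Hn.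
Qed.

(* The equations say that w = z' - x y' is constant and that the velocity
   (x', y') of the projection rotates with angular velocity w. *)
Lemma geodesic_projection (g : Ensemble point) :
  geodesic_curve g -> ~ fibre_line g ->
  line_or_circle (fun P => exists p, In _ g p /\ base_proj p = P).
Proof.
  intros (c & Hd & Hgeo & (s0 & t0 & Hne) & Himg) Hnf.
  pose proof (proj1 (geodesic_equation_iff c) Hgeo) as Heq. cbv zeta in Heq.
  pose proof (fun t => proj1 (Hd ax t)) as Hx1.
  pose proof (fun t => proj2 (Hd ax t)) as Hx2.
  pose proof (fun t => proj1 (Hd ay t)) as Hy1.
  pose proof (fun t => proj2 (Hd ay t)) as Hy2.
  pose proof (fun t => proj1 (Hd az t)) as Hz1.
  pose proof (fun t => proj2 (Hd az t)) as Hz2.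
  assert (Hc : forall t, c t = (coord ax (c t), coord ay (c t), coord az (c t))).
  { intros t. destruct (c t) as [[? ?] ?]. reflexivity. }
  clear Hd.
  set (x := fun t => coord ax (c t)) in *.
  set (y := fun t => coord ay (c t)) in *.
  set (z := fun t => coord az (c t)) in *.
  change (forall t, c t = (x t, y t, z t)) in Hc.
  pose (w := Derive z 0 - x 0 * Derive y 0).
  assert (Hw : forall t, Derive z t - x t * Derive y t = w).
  { apply (derive_zero_constant (fun t => Derive z t - x t * Derive y t)).
    intros t. destruct (Heq t) as (_ & _ & Ez).
    auto_derive; [repeat split; auto |].
    eta_derive. rewrite Ez. ring. }
  assert (HX : forall t, Derive (Derive x) t = - w * Derive y t).
  { intros t. rewrite <- (Hw t). apply Heq. }
  assert (HY : forall t, Derive (Derive y) t = w * Derive x t).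
  { intros t. rewrite <- (Hw t). apply Heq. }
  assert (HS : forall u v, In _ (fun P => exists p, In _ g p /\ base_proj p = P) (u, v)
    <-> exists t, x t = u /\ y t = v).
  { intros u v. unfold In at 1, base_proj. split.
    - intros (p & Hp & Hpuv). apply Himg in Hp. destruct Hp as (t & <-).
      exists t. rewrite Hc in Hpuv. simpl in Hpuv. injection Hpuv; auto.
    - intros (t & <- & <-). exists (c t). split.
      + apply Himg. exists t. reflexivity.
      + rewrite Hc. reflexivity. }
  destruct (Req_dec w 0) as [Hw0 | Hw0].
  (* For w = 0 the projection has constant velocity (a, b) and runs along a line. *)
  - left. set (a := Derive x 0). set (b := Derive y 0).
    assert (Hdx : forall t, Derive x t = a).
    { apply derive_zero_constant. intros t.
      replace 0 with (Derive (Derive x) t) by (rewrite HX, Hw0; ring).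
      apply Derive_correct, Hx2. }
    assert (Hdy : forall t, Derive y t = b).
    { apply derive_zero_constant. intros t.
      replace 0 with (Derive (Derive y) t) by (rewrite HY, Hw0; ring).
      apply Derive_correct, Hy2. }
    assert (Hxt : forall t, x t = x 0 + a * t).
    { intros t. enough (x t - a * t = x 0 - a * 0) by lra.
      apply (derive_zero_constant (fun t => x t - a * t)).
      intros s. auto_derive; [auto |]. eta_derive. rewrite Hdx. ring. }
    assert (Hyt : forall t, y t = y 0 + b * t).
    { intros t. enough (y t - b * t = y 0 - b * 0) by lra.
      apply (derive_zero_constant (fun t => y t - b * t)).
      intros s. auto_derive; [auto |]. eta_derive. rewrite Hdy. ring. }
    assert (Hab : a * a + b * b <> 0).
    (* With a = b = 0 also z' = w = 0, and the curve would be constant. *)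
    { intros Hab. apply Rplus_sqr_eq_0 in Hab. destruct Hab as [Ea Eb].
      assert (Hzt : forall t, z t = z 0).
      { apply derive_zero_constant. intros t.
        replace 0 with (Derive z t).
        - apply Derive_correct, Hz1.
        - pose proof (Hw t) as Hwt. rewrite Hdy, Eb in Hwt. lra. }
      apply Hne. rewrite !Hc.
      rewrite (Hxt s0), (Hxt t0), (Hyt s0), (Hyt t0), (Hzt s0), (Hzt t0), Ea, Eb.
      f_equal; f_equal; ring. }
    exists (- b), a, (- b * x 0 + a * y 0). split; [lra |].
    intros u v. rewrite HS. split.
    + intros (t & <- & <-). rewrite (Hxt t), (Hyt t). ring.
    (* The time comes from projecting (u - x 0, v - y 0) orthogonally onto (a, b). *)
    + intros Huv. exists ((a * (u - x 0) + b * (v - y 0)) / (a * a + b * b)).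
      rewrite (Hxt (_ / _)), (Hyt (_ / _)).
      assert (Hpar : a * (v - y 0) = b * (u - x 0)) by lra.
      split; apply (Rmult_eq_reg_l (a * a + b * b)); auto.
      * transitivity ((a * a + b * b) * x 0 + a * a * (u - x 0) + b * (a * (v - y 0)));
          [field; exact Hab | rewrite Hpar; ring].
      * transitivity ((a * a + b * b) * y 0 + b * b * (v - y 0) + a * (b * (u - x 0)));
          [field; exact Hab | rewrite <- Hpar; ring].
  - right.
    (* The conserved quantities x' + w y = w o2 and y' - w x = -w o1 determine the centre of
       rotation. *)
    pose (o1 := x 0 - Derive y 0 / w). pose (o2 := y 0 + Derive x 0 / w).
    assert (Hdx : forall t, Derive x t = - w * (y t - o2)).
    { intros t. enough (Derive x t + w * y t = Derive x 0 + w * y 0).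
      { unfold o2. transitivity (Derive x 0 + w * y 0 - w * y t);
          [lra | field; exact Hw0]. }
      apply (derive_zero_constant (fun t => Derive x t + w * y t)).
      intros s. auto_derive; [auto |]. eta_derive. rewrite HX. ring. }
    assert (Hdy : forall t, Derive y t = w * (x t - o1)).
    { intros t. enough (Derive y t - w * x t = Derive y 0 - w * x 0).
      { unfold o1. transitivity (Derive y 0 - w * x 0 + w * x t);
          [lra | field; exact Hw0]. }
      apply (derive_zero_constant (fun t => Derive y t - w * x t)).
      intros s. auto_derive; [auto |]. eta_derive. rewrite HY. ring. }
    pose (p := x 0 - o1). pose (q := y 0 - o2).
    (* Turning the position relative to the centre back by the angle w t gives a vector with zero
       derivative. This solves the system without a uniqueness theorem for differential
       equations. *)
    assert (Hp : forall t, (x t - o1) * cos (w * t) + (y t - o2) * sin (w * t) = p).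
    { intros t. transitivity ((x 0 - o1) * cos (w * 0) + (y 0 - o2) * sin (w * 0)).
      2: { rewrite Rmult_0_r, cos_0, sin_0. unfold p. ring. }
      apply (derive_zero_constant
        (fun t => (x t - o1) * cos (w * t) + (y t - o2) * sin (w * t))).
      intros s. auto_derive; [auto |]. eta_derive. rewrite Hdx, Hdy. ring. }
    assert (Hq : forall t, (y t - o2) * cos (w * t) - (x t - o1) * sin (w * t) = q).
    { intros t. transitivity ((y 0 - o2) * cos (w * 0) - (x 0 - o1) * sin (w * 0)).
      2: { rewrite Rmult_0_r, cos_0, sin_0. unfold q. ring. }
      apply (derive_zero_constant
        (fun t => (y t - o2) * cos (w * t) - (x t - o1) * sin (w * t))).
      intros s. auto_derive; [auto |]. eta_derive. rewrite Hdx, Hdy. ring. }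
    assert (Hcs : forall t, cos t * cos t + sin t * sin t = 1).
    { intros t. pose proof (sin2_cos2 t). unfold Rsqr in *. lra. }
    assert (Hxt : forall t, x t - o1 = p * cos (w * t) - q * sin (w * t)).
    { intros t. rewrite <- (Hp t), <- (Hq t).
      transitivity ((x t - o1) * (cos (w * t) * cos (w * t) + sin (w * t) * sin (w * t)));
        [rewrite Hcs |]; ring. }
    assert (Hyt : forall t, y t - o2 = p * sin (w * t) + q * cos (w * t)).
    { intros t. rewrite <- (Hp t), <- (Hq t).
      transitivity ((y t - o2) * (cos (w * t) * cos (w * t) + sin (w * t) * sin (w * t)));
        [rewrite Hcs |]; ring. }
    (* If the radius were zero, the projection would be one point and z would grow at the constant
       rate w, nonzero here; the curve would fill a whole fibre. *)
    assert (Hpq : p * p + q * q <> 0).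
    { intros Hpq. apply Rplus_sqr_eq_0 in Hpq. destruct Hpq as [Ep Eq].
      assert (Hx0 : forall t, x t = o1)
        by (intros t; pose proof (Hxt t) as E; rewrite Ep, Eq in E; lra).
      assert (Hy0 : forall t, y t = o2)
        by (intros t; pose proof (Hyt t) as E; rewrite Ep, Eq in E; lra).
      assert (Hzt : forall t, z t = z 0 + w * t).
      { intros t. enough (z t - w * t = z 0 - w * 0) by lra.
        apply (derive_zero_constant (fun t => z t - w * t)).
        intros s. auto_derive; [auto |]. eta_derive.
        pose proof (Hw s) as Hws. rewrite Hdy, Hx0 in Hws. lra. }
      apply Hnf. exists (o1, o2). split; intros P HP.
      - apply Himg in HP. destruct HP as (t & <-). unfold In, fibre, base_proj.
        rewrite Hc, Hx0, Hy0. reflexivity.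
      - destruct P as [P h]. unfold In, fibre, base_proj in HP. simpl in HP. subst P.
        apply Himg. exists ((h - z 0) / w). rewrite Hc, Hx0, Hy0, Hzt.
        f_equal. field. exact Hw0. }
    exists o1, o2, (p * p + q * q). split.
    { pose proof (Rle_0_sqr p). pose proof (Rle_0_sqr q). unfold Rsqr in *. lra. }
    intros u v. rewrite HS. split.
    + intros (t & <- & <-). rewrite (Hxt t), (Hyt t).
      transitivity ((p * p + q * q)
        * (cos (w * t) * cos (w * t) + sin (w * t) * sin (w * t)));
        [| rewrite Hcs]; ring.
    (* The angle s that carries (p, q) to the given point is reached at time s / w. *)
    + intros Huv. destruct (rotation_to p q _ _ Hpq Huv) as (s & Eu & Ev).
      exists (s / w). pose proof (Hxt (s / w)) as E1. pose proof (Hyt (s / w)) as E2.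
      replace (w * (s / w)) with s in E1, E2 by (field; exact Hw0). lra.
Qed.

(** * Explicit geodesics over lines and circles *)

(** The condition z' = w + x y' is the first integral of the fibre component; differentiating it
    gives the equation for z''. Derivatives are supplied as functions, so that explicit curves need
    only direct computations. *)
Lemma geodesic_curve_of_velocity (x y z x' y' z' x'' y'' : R -> R) (w : R) :
  (forall t, is_derive x t (x' t)) -> (forall t, is_derive y t (y' t)) ->
  (forall t, is_derive z t (z' t)) ->
  (forall t, is_derive x' t (x'' t)) -> (forall t, is_derive y' t (y'' t)) ->
  (forall t, x'' t = - w * y' t) -> (forall t, y'' t = w * x' t) ->
  (forall t, z' t = w + x t * y' t) ->
  (exists s t, (x s, y s, z s) <> (x t, y t, z t)) ->
  geodesic_curve (fun p => exists t, (x t, y t, z t) = p).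
Proof.
  intros Hx Hy Hz Hx' Hy' Ex Ey Ez Hne.
  assert (Dx : forall t, Derive x t = x' t) by (intros; apply is_derive_unique; auto).
  assert (Dy : forall t, Derive y t = y' t) by (intros; apply is_derive_unique; auto).
  assert (Dz : forall t, Derive z t = z' t) by (intros; apply is_derive_unique; auto).
  assert (Hz' : forall t, is_derive z' t (x' t * y' t + x t * y'' t)).
  { intros t. apply is_derive_ext with (fun s => w + x s * y' s); [auto |].
    auto_derive.
    - split; [exists (x' t); apply Hx | split; [exists (y'' t); apply Hy' | exact I]].
    - eta_derive. rewrite (is_derive_unique _ _ _ (Hx t)),
        (is_derive_unique _ _ _ (Hy' t)). ring. }
  assert (Hx2 : forall t, is_derive (Derive x) t (x'' t))
    by (intros t; apply is_derive_ext with x'; auto).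
  assert (Hy2 : forall t, is_derive (Derive y) t (y'' t))
    by (intros t; apply is_derive_ext with y'; auto).
  assert (Hz2 : forall t, is_derive (Derive z) t (x' t * y' t + x t * y'' t))
    by (intros t; apply is_derive_ext with z'; auto).
  exists (fun t => (x t, y t, z t)). split; [| split; [| split; [exact Hne | reflexivity]]].
  - intros i t. destruct i; simpl; split; eexists; eauto.
  - apply (proj2 (geodesic_equation_iff _)). simpl. intros t.
    change (Derive (fun t => x t)) with (Derive x).
    change (Derive (fun t => y t)) with (Derive y).
    change (Derive (fun t => z t)) with (Derive z).
    rewrite (is_derive_unique _ _ _ (Hx2 t)), (is_derive_unique _ _ _ (Hy2 t)),
      (is_derive_unique _ _ _ (Hz2 t)), Dx, Dy, Dz, Ex, Ey, Ez.
    repeat split; ring.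
Qed.

Lemma nil_equivalent_refl (g : Ensemble point) : nil_equivalent g g.
Proof.
  exists (fun p => p). split.
  - split; [exists (fun p => p); auto |].
    intros p. exists (fun v => v). split; [apply filterdiff_id | reflexivity].
  - intros q. split; [intros Hq; exists q; auto | intros (p & Hp & <-); exact Hp].
Qed.

Lemma not_fibre_line (g : Ensemble point) (p q : point) :
  In _ g p -> In _ g q -> base_proj p <> base_proj q -> ~ fibre_line g.
Proof.
  intros Hp Hq Hpq (P & HP & _). apply Hpq.
  rewrite (HP p Hp). symmetry. exact (HP q Hq).
Qed.

(** The base curve is traversed with w = 0 if it is a line and with w = 1 if it is a circle,
    starting below M; integrating z' = w + x y' from the height of M gives the lift. *)
Lemma geodesic_through (S : Ensemble base_point) (M : point) :
  line_or_circle S -> In _ S (base_proj M) ->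
  exists g, geodesic_curve g /\ ~ fibre_line g
    /\ (forall p, In _ g p -> In _ S (base_proj p)) /\ In _ g M.
Proof.
  destruct M as [[x0 y0] z0]. unfold base_proj; simpl.
  intros [(a & b & k & Hab & HS) | (u & v & s & Hs & HS)] HM; apply HS in HM.
  - pose (x := fun t => x0 - b * t). pose (y := fun t => y0 + a * t).
    pose (z := fun t => z0 + a * x0 * t - a * b * t * t / 2).
    exists (fun p => exists t, (x t, y t, z t) = p). split; [| split; [| split]].
    + apply geodesic_curve_of_velocity with
        (x' := fun _ => - b) (y' := fun _ => a)
        (z' := fun t => a * x0 - a * b * t) (x'' := fun _ => 0)
        (y'' := fun _ => 0) (w := 0); unfold x, y, z; try (intros; simpl; ring).
      1-5: intros; auto_derive; auto; field.
      exists 0, 1. intros H. injection H as Hx Hy _. apply Hab.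
      replace a with 0 by lra. replace b with 0 by lra. ring.
    + apply not_fibre_line with (x 0, y 0, z 0) (x 1, y 1, z 1).
      * exists 0. reflexivity.
      * exists 1. reflexivity.
      * unfold x, y. simpl. intros H. injection H as Hx Hy. apply Hab.
        replace a with 0 by lra. replace b with 0 by lra. ring.
    + intros p (t & <-). apply HS. unfold x, y. simpl. lra.
    + exists 0. unfold x, y, z. f_equal; [f_equal |]; field.
  - pose (p := x0 - u). pose (q := y0 - v).
    pose (X := fun t => p * cos t - q * sin t).
    pose (Y := fun t => p * sin t + q * cos t).
    assert (Hcs : forall t, cos t * cos t + sin t * sin t = 1).
    { intros t. pose proof (sin2_cos2 t). unfold Rsqr in *. lra. }
    assert (HXY : forall t, X t * X t + Y t * Y t = s).
    { intros t. rewrite <- HM. unfold X, Y.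
      transitivity ((p * p + q * q) * (cos t * cos t + sin t * sin t));
        [| rewrite Hcs; unfold p, q]; ring. }
    pose (x := fun t => u + X t). pose (y := fun t => v + Y t).
    (* A primitive of z' = 1 + x y' = 1 + (u + X) X: here X = Y' and
       (X Y)' = X^2 - Y^2 = 2 X^2 - s. *)
    pose (z := fun t =>
      z0 + t + u * (Y t - q) + (s * t + X t * Y t - p * q) / 2).
    exists (fun p => exists t, (x t, y t, z t) = p).
    (* Times 0 and PI give antipodal points of the circle. Their distinctness shows both that the
       curve is not constant and that it is not a fibre line. *)
    assert (Hfar : (x 0, y 0) <> (x PI, y PI)).
    { unfold x, y, X, Y. rewrite cos_0, sin_0, cos_PI, sin_PI. intros H.
      injection H as Hx Hy.
      assert (Ep : p = 0) by lra. assert (Eq : q = 0) by lra.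
      fold p q in HM. rewrite Ep, Eq in HM. lra. }
    split; [| split; [| split]].
    + apply geodesic_curve_of_velocity with
        (x' := fun t => - Y t) (y' := X)
        (z' := fun t => 1 + u * X t + (s + (X t * X t - Y t * Y t)) / 2)
        (x'' := fun t => - X t)
        (y'' := fun t => - Y t) (w := 1); unfold x, y, z.
      1, 2, 4, 5: intros; unfold X, Y; auto_derive; auto; field.
      * intros t. unfold X, Y. auto_derive; auto. field.
      * intros; ring.
      * intros; ring.
      (* By X^2 + Y^2 = s, the term (s + (X^2 - Y^2)) / 2 equals X^2. *)
      * intros t. rewrite <- (HXY t). field.
      * exists 0, PI. intros H. apply Hfar. injection H as Hx Hy _.
        unfold x, y. rewrite Hx, Hy. reflexivity.
    + apply not_fibre_line with (x 0, y 0, z 0) (x PI, y PI, z PI).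
      * exists 0. reflexivity.
      * exists PI. reflexivity.
      * exact Hfar.
    + intros P (t & <-). apply HS. rewrite <- (HXY t). unfold x, y. simpl. ring.
    + exists 0. unfold x, y, z, X, Y. rewrite cos_0, sin_0. unfold p, q.
      f_equal; [f_equal |]; field.
Qed.

(** * Geodesics on cylinders and their intersection points *)

Lemma geodesic_on_cylinder_through (X Y Z : base_point) (M : point) :
  distinct3 X Y Z -> In _ (cylinder X Y Z) M ->
  exists g, geodesic_on_cylinder (cylinder X Y Z) g /\ In _ g M.
Proof.
  intros Hd (P & HP & HMP). apply circle_or_line_vertices in Hd.
  destruct Hd as [HS _]. rewrite <- HMP in HP.
  destruct (geodesic_through _ M HS HP) as (g & Hg & Hnf & Hsub & HM).
  assert (Hcyl : Included _ g (cylinder X Y Z)).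
  { intros p Hp. exists (base_proj p). split; [apply Hsub, Hp | reflexivity]. }
  exists g. split; [| exact HM]. repeat split; auto.
  (* The geodesic represents its own class, by the identity isometry. *)
  exists g. auto using nil_equivalent_refl.
Qed.

(** The projection of [g] is a line or circle inside the base curve of the cylinder, hence all of
    it; so P is the projection of some point of [g]. *)
Lemma geodesic_meets_fibres (X Y Z P : base_point) (g : Ensemble point) :
  distinct3 X Y Z -> geodesic_curve g -> ~ fibre_line g ->
  Included _ g (cylinder X Y Z) -> In _ (circle_or_line X Y Z) P ->
  exists M, In _ g M /\ In _ (fibre P) M.
Proof.
  intros Hd Hg Hnf Hsub HP.
  refine (line_or_circle_included _ _ (geodesic_projection g Hg Hnf)
    (proj1 (circle_or_line_vertices _ _ _ Hd)) _ P HP).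
  intros Q (p & Hp & <-). destruct (Hsub p Hp) as (R & HR & HpR).
  rewrite HpR. exact HR.
Qed.

(** A point of a common fibre lies on both cylinders, and each cylinder carries its own geodesic
    through that point. *)
Lemma meet_in_two_fibres_geodesics (X Y Z X' Y' Z' m m' : base_point) (M : point) :
  distinct3 X Y Z -> distinct3 X' Y' Z' ->
  meet_in_two_fibres (cylinder X Y Z) (cylinder X' Y' Z') m m' ->
  In _ (fibre m) M ->
  exists g g', geodesic_on_cylinder (cylinder X Y Z) g
    /\ geodesic_on_cylinder (cylinder X' Y' Z') g' /\ In _ g M /\ In _ g' M.
Proof.
  intros Hd Hd' (_ & _ & _ & Hmeet) HM.
  destruct (Hmeet M (Union_introl _ _ _ _ HM)) as [N HN HN'].
  destruct (geodesic_on_cylinder_through _ _ _ N Hd HN) as (g & Hg & HgN).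
  destruct (geodesic_on_cylinder_through _ _ _ N Hd' HN') as (g' & Hg' & HgN').
  exists g, g'. auto.
Qed.

Theorem theorem3p10
  (A1 A2 A3 B1 B2 B3 A1' A2' A3' B1' B2' B3' : base_point)
  (m1 m1' m2 m2' m3 m3' : base_point)
  (Hconf : pappus_configuration A1 A2 A3 B1 B2 B3 A1' A2' A3' B1' B2' B3')
  (Hm1 : meet_in_two_fibres (cylinder A1 B2 A1') (cylinder B1 A2 B1') m1 m1')
  (Hm2 : meet_in_two_fibres (cylinder B3 A1 B3') (cylinder A3 B1 A3') m2 m2')
  (Hm3 : meet_in_two_fibres (cylinder B2 A3 B2') (cylinder A2 B3 A2') m3 m3')
  (Hm : distinct3 m1 m2 m3)
  (g : Ensemble point)
  (Hg : geodesic_curve g)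
  (Hg_fibre : ~ fibre_line g)
  (Hg_cyl : Included _ g (cylinder m1 m2 m3)) :
  exists g_A1B2 g_A2B1 g_A1B3 g_A3B1 g_A3B2 g_A2B3 : Ensemble point,
    geodesic_on_cylinder (cylinder A1 B2 A1') g_A1B2
    /\ geodesic_on_cylinder (cylinder B1 A2 B1') g_A2B1
    /\ geodesic_on_cylinder (cylinder B3 A1 B3') g_A1B3
    /\ geodesic_on_cylinder (cylinder A3 B1 A3') g_A3B1
    /\ geodesic_on_cylinder (cylinder B2 A3 B2') g_A3B2
    /\ geodesic_on_cylinder (cylinder A2 B3 A2') g_A2B3
    /\ exists M1 M2 M3 : point,
         (In _ (fibre m1) M1 /\ In _ g_A1B2 M1 /\ In _ g_A2B1 M1)
         /\ (In _ (fibre m2) M2 /\ In _ g_A1B3 M2 /\ In _ g_A3B1 M2)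
         /\ (In _ (fibre m3) M3 /\ In _ g_A3B2 M3 /\ In _ g_A2B3 M3)
         /\ In _ g M1 /\ In _ g M2 /\ In _ g M3.
Proof.
  (* The given geodesic fixes M1, M2, M3 first; the six geodesics are then chosen in pairs through
     these points. *)
  destruct (circle_or_line_vertices m1 m2 m3 Hm) as (_ & Hin1 & Hin2 & Hin3).
  destruct (geodesic_meets_fibres _ _ _ m1 g Hm Hg Hg_fibre Hg_cyl
    Hin1) as (M1 & HM1 & HF1).
  destruct (geodesic_meets_fibres _ _ _ m2 g Hm Hg Hg_fibre Hg_cyl
    Hin2) as (M2 & HM2 & HF2).
  destruct (geodesic_meets_fibres _ _ _ m3 g Hm Hg Hg_fibre Hg_cyl
    Hin3) as (M3 & HM3 & HF3).
  destruct Hconf.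
  destruct (meet_in_two_fibres_geodesics _ _ _ _ _ _ _ _ M1
    pappus_A1B2 pappus_B1A2 Hm1 HF1) as (g1 & h1 & ? & ? & ? & ?).
  destruct (meet_in_two_fibres_geodesics _ _ _ _ _ _ _ _ M2
    pappus_B3A1 pappus_A3B1 Hm2 HF2) as (g2 & h2 & ? & ? & ? & ?).
  destruct (meet_in_two_fibres_geodesics _ _ _ _ _ _ _ _ M3
    pappus_B2A3 pappus_A2B3 Hm3 HF3) as (g3 & h3 & ? & ? & ? & ?).
  exists g1, h1, g2, h2, g3, h3. do 6 (split; [assumption |]).
  exists M1, M2, M3. repeat split; assumption.
Qed.
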